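(* There exists $U_p\in \mathrm{PSym}(2)$ such that the function $$\mathrm{GL}^+(2)\ni F\mapsto e^{\|\operatorname{dev}_2\log U-\operatorname{dev}_2\log U_p\|^2},\qquad U=\sqrt{F^TF},$$ is not rank-one convex, while the function $$\mathrm{GL}^+(2)\ni F\mapsto e^{\|\operatorname{dev}_2\log U\|^2},\qquad U=\sqrt{F^TF},$$ is rank-one convex.
   Context: $\mathrm{GL}^+(2)=\{X\in\mathbb{R}^{2\times 2} : \det X>0\}$, and $\mathrm{PSym}(2)$ is the set of symmetric positive definite real $2\times 2$ matrices. For $F\in\mathrm{GL}^+(2)$, $U=\sqrt{F^TF}\in\mathrm{PSym}(2)$ is the unique element of $\mathrm{PSym}(2)$ with $U^2=F^TF$ (the right stretch tensor). For $X\in\mathrm{PSym}(2)$ with spectral decomposition $X=\sum_{i=1}^2\lambda_i\,N_i\otimes N_i$ ($\lambda_i>0$ the eigenvalues, $N_i$ orthonormal eigenvectors), $\log X=\sum_{i=1}^2 \log\lambda_i\,(N_i\otimes N_i)$ is the principal matrix logarithm. For $X\in\mathbb{R}^{2\times 2}$, $\operatorname{dev}_2X=X-\tfrac12\operatorname{tr}(X)\,\mathbb{1}$ is the deviatoric part, where $\mathbb{1}$ is the identity matrix, and $\|X\|^2=\operatorname{tr}(XX^T)$ is the squared Frobenius norm. The matrix $U_p$ is fixed (independent of $F$) and is called the plastic stretch. For $\xi,\eta\in\mathbb{R}^2$, $(\xi\otimes\eta)_{ij}=\xi_i\eta_j$. A function $W:\mathrm{GL}^+(2)\to\mathbb{R}$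 is called rank-one convex if for every $F\in\mathrm{GL}^+(2)$ and all $\xi,\eta\in\mathbb{R}^2$ the function $t\mapsto W(F+t\,\xi\otimes\eta)$ is convex on the set $\{t\in\mathbb{R} : \det(F+t\,\xi\otimes\eta)>0\}$, which is an interval because $t\mapsto\det(F+t\,\xi\otimes\eta)$ is affine. *)

(* Defs.v *)
From HB Require Import structures.
From mathcomp Require Import all_boot all_order all_algebra.
From mathcomp Require Import all_classical all_reals all_analysis.

Set Implicit Arguments.
Unset Strict Implicit.
Unset Printing Implicit Defensive.

Import Order.TTheory GRing.Theory Num.Theory.

Local Open Scope classical_set_scope.
Local Open Scope ring_scope.

Section Defs.
Variable R : realType.
Implicit Types (X F : 'M[R]_2) (xi eta : 'cV[R]_2).

Definition GLplus : set 'M[R]_2 := [set X | 0 < \det X].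

Definition PSym : set 'M[R]_2 :=
  [set X | X^T = X /\
    forall x : 'cV[R]_2, x != 0 -> 0 < (x^T *m X *m x) ord0 ord0].

Definition outer xi eta : 'M[R]_2 :=
  \matrix_(i, j) (xi i ord0 * eta j ord0).

Definition orthonormal_frame (N : 'I_2 -> 'cV[R]_2) : Prop :=
  forall i j, (N i)^T *m N j = (i == j)%:R%:M.

Definition spectral_decomposition X (lambda : 'I_2 -> R)
    (N : 'I_2 -> 'cV[R]_2) : Prop :=
  orthonormal_frame N /\ X = \sum_i lambda i *: outer (N i) (N i).

(* [xget 0 A] is an element of [A], or the junk value 0 when [A] is empty.
   For [X] in [PSym] the sets below are singletons, so [sqrtm] and [logm] are
   the square root and the principal logarithm there; [logm] does not depend
   on the choice of the spectral decomposition. *)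
Definition sqrtm X : 'M[R]_2 := xget 0 [set U | PSym U /\ U *m U = X].

Definition logm X : 'M[R]_2 :=
  xget 0 [set L | exists (lambda : 'I_2 -> R) (N : 'I_2 -> 'cV[R]_2),
    [/\ forall i, 0 < lambda i,
        spectral_decomposition X lambda N
      & L = \sum_i ln (lambda i) *: outer (N i) (N i)]].

Definition right_stretch F : 'M[R]_2 := sqrtm (F^T *m F).

Definition dev2 X : 'M[R]_2 := X - (2^-1 * \tr X) *: 1%:M.

(* The Frobenius norm, unlike the sup norm [`|X|] that the library puts on
   matrices. *)
Definition frobenius_sq X : R := \tr (X *m X^T).

(* [W] is total, but only its values on [GLplus] are constrained. *)
Definition rank_one_convex (W : 'M[R]_2 -> R) : Prop :=
  forall F, GLplus F -> forall xi eta,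
    convex_function
      ([set t | GLplus (F + t *: outer xi eta)] : set R^o)
      (fun t : R^o => W (F + (t : R) *: outer xi eta)).

End Defs.

Arguments GLplus {R}.
Arguments PSym {R}.

(* Main.v *)
(* If the stretch U has eigenvalues l0, l1 and s = ln l0 - ln l1, then the
   energy without plastic stretch is exp (s^2 / 2), while
   cosh s = |F|^2 / (2 det F). The latter is convex along rank-one lines, where
   det is affine, and exp (s^2 / 2) is a convex nondecreasing function of cosh s
   because t exp (t^2 / 2) / sinh t is nondecreasing for t > 0.
   With U_p = diag (2, 1/2), consider the simple shear F(t) = 1 + t e2 (x) e1.
   The exponent is 2 (ln 2)^2 at t = 0 but only (8/5) (ln 2)^2 at t = 3/2 and
   t = -3/2, so midpoint convexity fails at the identity. *)
Require Import Defs.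
From HB Require Import structures.
From mathcomp Require Import all_boot all_order all_algebra ring lra.
From mathcomp Require Import all_classical all_reals all_analysis.

Set Implicit Arguments.
Unset Strict Implicit.
Unset Printing Implicit Defensive.

Import Order.TTheory GRing.Theory Num.Theory.
Import numFieldNormedType.Exports.

Local Open Scope ring_scope.

(** * One-variable analysis: [exp (t^2 / 2)] as a function of [cosh t] *)

Section Hyperbolic.
Variable R : realType.
Implicit Types s t : R.

(** Mean value theorem; every monotonicity claim of this section rests on it. *)
Lemma derive_ge0_le (f df : R -> R) (a b : R) : a <= b ->
  (forall x, a <= x <= b -> is_derive x 1 f (df x)) ->
  (forall x, a <= x <= b -> 0 <= df x) -> f a <= f b.
Proof.
move=> ab fdf df0.
have [||c cab fba] := @MVT_segment R f df a b ab.
- by move=> x; rewrite in_itv/= => /andP[? ?]; apply: fdf; rewrite !ltW.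
- by apply: derivable_within_continuous => x; rewrite in_itv/= => /fdf[].
by rewrite -subr_ge0 fba mulr_ge0 ?subr_ge0// df0.
Qed.

Definition cosh t : R := (expR t + expR (- t)) / 2.
Definition sinh t : R := (expR t - expR (- t)) / 2.
Definition gauss t : R := expR (t ^+ 2 / 2).

Lemma is_derive_expRN t : is_derive t 1 (fun u => expR (- u)) (- expR (- t)).
Proof.
have H := is_derive1_comp (is_derive_expR (- t)) (is_deriveNid t 1).
apply: is_derive_eq H _.
by rewrite mulrN1.
Qed.

Lemma is_derive_cosh t : is_derive t 1 cosh (sinh t).
Proof.
have H := is_deriveM
  (is_deriveD (is_derive_expR t) (is_derive_expRN t))
  (is_derive_cst (2^-1 : R) t 1).
apply: is_derive_eq H _.
by rewrite scaler0 add0r /GRing.scale/= mulrC.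
Qed.

Lemma is_derive_sinh t : is_derive t 1 sinh (cosh t).
Proof.
have H := is_deriveM
  (is_deriveB (is_derive_expR t) (is_derive_expRN t))
  (is_derive_cst (2^-1 : R) t 1).
apply: is_derive_eq H _.
by rewrite scaler0 add0r opprK /GRing.scale/= mulrC.
Qed.

Lemma is_derive_gauss t : is_derive t 1 gauss (t * gauss t).
Proof.
have H := is_deriveM (is_deriveX 2 (is_derive_id t (1 : R)))
  (is_derive_cst (2^-1 : R) t 1).
apply: is_derive_eq (is_derive1_comp (is_derive_expR _) H) _.
rewrite scaler0 add0r /gauss /GRing.scale/= expr1 mulr1 mulrC; congr (_ * _).
by rewrite mulrA mulVf ?mul1r// pnatr_eq0.
Qed.

Lemma cosh_ge0 t : 0 <= cosh t.
Proof. by rewrite divr_ge0// addr_ge0// expR_ge0. Qed.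

Lemma sinh_ge0 t : 0 <= t -> 0 <= sinh t.
Proof.
by move=> t0; rewrite divr_ge0// subr_ge0 ler_expR (le_trans _ t0)// oppr_le0.
Qed.

Lemma sinh_gt0 t : 0 < t -> 0 < sinh t.
Proof.
by move=> t0; rewrite divr_gt0// subr_gt0 ltr_expR (lt_trans _ t0)// oppr_lt0.
Qed.

Lemma coshN t : cosh (- t) = cosh t.
Proof. by rewrite /cosh opprK addrC. Qed.

Lemma gaussN t : gauss (- t) = gauss t.
Proof. by rewrite /gauss sqrrN. Qed.

Lemma cosh_abs t : cosh `|t| = cosh t.
Proof. by case: (ger0P t) => _ //; rewrite coshN. Qed.

Lemma gauss_abs t : gauss `|t| = gauss t.
Proof. by rewrite /gauss real_normK ?num_real. Qed.

(** The difference of the two sides vanishes at 0 and has derivative [t sinh t + t^2 cosh t]. It is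
    the factor that decides the sign of the derivative of [ratio]. *)
Lemma mul_cosh_le_sinh t : 0 <= t -> t * cosh t <= (1 + t ^+ 2) * sinh t.
Proof.
move=> t0; rewrite -subr_ge0.
pose f u := (1 + u ^+ 2) * sinh u - u * cosh u.
have -> : 0 = f 0 by rewrite /f /sinh /cosh oppr0; ring.
apply: (@derive_ge0_le f (fun u => u * sinh u + u ^+ 2 * cosh u) 0 t t0) => u.
  move=> _; have H := is_deriveB
    (is_deriveM (is_deriveD (is_derive_cst (1 : R) u 1)
                            (is_deriveX 2 (is_derive_id u (1 : R))))
                (is_derive_sinh u))
    (is_deriveM (is_derive_id u (1 : R)) (is_derive_cosh u)).
  apply: is_derive_eq H _.
  rewrite /GRing.scale/=.
  (* The derivative rules yield operations on functions; they are evaluated at [u] so that [ring]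
     applies. *)
  change ((1 + u ^+ 2) * cosh u + sinh u * (0 + 2 * u ^+ 1 * 1)
    - (u * sinh u + cosh u * 1) = u * sinh u + u ^+ 2 * cosh u).
  by ring.
case/andP=> u0 _.
by rewrite addr_ge0// mulr_ge0 ?sinh_ge0 ?cosh_ge0 ?sqr_ge0.
Qed.

Definition ratio t := t * gauss t / sinh t.

(** By the quotient rule, the derivative has the sign of the gap in [mul_cosh_le_sinh]. *)
Lemma ratio_nondecreasing s t : 0 < s -> s <= t -> ratio s <= ratio t.
Proof.
move=> s0 st.
pose df u := gauss u * ((1 + u ^+ 2) * sinh u - u * cosh u) / sinh u ^+ 2.
apply: (@derive_ge0_le ratio df s t st) => u /andP[su _];
    have u0 := lt_le_trans s0 su.
  have shu : sinh u != 0 by rewrite gt_eqF// sinh_gt0.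
  have H := is_deriveM (is_deriveM (is_derive_id u (1 : R)) (is_derive_gauss u))
     (is_deriveV shu (is_derive_sinh u)).
  apply: is_derive_eq H _.
  rewrite /GRing.scale/= /df.
  change (u * gauss u * (- (sinh u) ^- 2 * cosh u)
    + (sinh u)^-1 * (u * (u * gauss u) + gauss u * 1) =
    gauss u * ((1 + u ^+ 2) * sinh u - u * cosh u) / sinh u ^+ 2).
  by field.
rewrite divr_ge0 ?sqr_ge0// mulr_ge0 ?expR_ge0// subr_ge0.
by rewrite mul_cosh_le_sinh// ltW.
Qed.

(* Supporting lines: [gauss] is a convex nondecreasing function of [cosh],
   because its derivative with respect to [cosh t] is [ratio t]. *)
Lemma gauss_cosh_support s : exists2 m, 0 <= m &
  forall t, gauss s + m * (cosh t - cosh s) <= gauss t.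
Proof.
(* [ratio] is a true quotient only away from 0; at [s = 0] the slope 0 suffices, because [gauss] is
   minimal there. *)
have [->|s0] := eqVneq s 0.
  exists 0 => // t; rewrite mul0r addr0 ler_expR expr0n/= mul0r.
  by rewrite divr_ge0// sqr_ge0.
(* [gauss] and [cosh] are even, which reduces to [s > 0] here and to [t >= 0] below. *)
wlog : s s0 / 0 < s => [hw|{}s0].
  case: (ltrP 0 s) => [/hw|]; first exact.
  rewrite le_eqVlt (negbTE s0)/= => sn.
  have [||m m0 H] := hw (- s); rewrite ?oppr_eq0 ?oppr_gt0//.
  by exists m => // t; have := H t; rewrite gaussN coshN.
have m0 : 0 <= ratio s.
  by rewrite divr_ge0 ?sinh_ge0 ?mulr_ge0 ?expR_ge0// ltW.
exists (ratio s) => // t.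
suff {t} H t : 0 <= t -> gauss s + ratio s * (cosh t - cosh s) <= gauss t.
  by rewrite -(cosh_abs t) -(gauss_abs t) H.
move=> t0.
(* The derivative of [h 1] is [(ratio u - ratio s) sinh u], which changes sign at [s]. Taking
   [c = 1] to the right of [s] and [c = -1] to the left makes it nonnegative on both sides. *)
pose h c u := c * (gauss u - ratio s * cosh u).
suff hst : h 1 s <= h 1 t by move: hst; rewrite /h !mul1r; lra.
pose dh c u := c * (u * gauss u - ratio s * sinh u).
have hdh (c u : R) : is_derive u 1 (h c) (dh c u).
  have H := is_deriveZ c (is_deriveB (is_derive_gauss u)
    (is_deriveZ (ratio s) (is_derive_cosh u))).
  by apply: is_derive_eq H _.
have dhE (u : R) : 0 < u ->
    u * gauss u - ratio s * sinh u = (ratio u - ratio s) * sinh u.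
  by move=> u0; rewrite mulrBl /ratio divfK ?gt_eqF ?sinh_gt0.
have [st|ts] := leP s t.
  apply: (@derive_ge0_le _ (dh 1) _ _ st) => u // /andP[su _].
  have u0 := lt_le_trans s0 su.
  rewrite /dh mul1r dhE// mulr_ge0// ?subr_ge0 ?ratio_nondecreasing//.
  by rewrite sinh_ge0// ltW.
suff : h (-1) t <= h (-1) s by rewrite /h; lra.
apply: (@derive_ge0_le _ (dh (-1)) _ _ (ltW ts)) => u // /andP[tu us].
(* This endpoint occurs only when [t = 0]; [dhE] needs [u > 0], so the derivative is computed
   directly. *)
have [->|u0] := eqVneq u 0.
  by rewrite /dh /sinh oppr0 subrr mul0r mul0r mulr0 subrr mulr0.
have {}u0 : 0 < u by rewrite lt_neqAle eq_sym u0 (le_trans t0).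
rewrite /dh dhE// mulN1r -mulNr opprB mulr_ge0 ?sinh_ge0 ?(ltW u0)//.
by rewrite subr_ge0 ratio_nondecreasing.
Qed.

End Hyperbolic.

(** * Spectral sums, and the values of [logm] and [sqrtm] on them *)

Section Spectral.
Variable R : realType.
Implicit Types (X U V F L : 'M[R]_2) (N : 'I_2 -> 'cV[R]_2) (f g : 'I_2 -> R).

Lemma sum_ord2 (V : nmodType) (h : 'I_2 -> V) : \sum_i h i = h 0 + h 1.
Proof.
rewrite !big_ord_recl big_ord0 addr0.
by congr (_ + h _); apply/val_inj.
Qed.

Lemma ord2P (P : 'I_2 -> Prop) : P 0 -> P 1 -> forall i, P i.
Proof.
move=> P0 P1 [[|[|//]] i].
  by rewrite (_ : Ordinal i = 0)//; apply/val_inj.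
by rewrite (_ : Ordinal i = 1)//; apply/val_inj.
Qed.

Lemma matrix2P (A B : 'M[R]_2) :
  A 0 0 = B 0 0 -> A 0 1 = B 0 1 -> A 1 0 = B 1 0 -> A 1 1 = B 1 1 -> A = B.
Proof. by move=> *; apply/matrixP; apply: ord2P; apply: ord2P. Qed.

Definition spectral_sum f N : 'M[R]_2 := \sum_i f i *: outer (N i) (N i).

Lemma cV_neq0 n (y : 'cV[R]_n) : y != 0 -> exists i, y i ord0 != 0.
Proof.
move=> y0; apply/existsP; apply: contra_neqT y0.
rewrite negb_exists => /forallP h; apply/matrixP => i j.
by rewrite ord1 [RHS]mxE; apply/eqP; have := h i; rewrite negbK.
Qed.

Definition frame_mx N : 'M[R]_2 := \matrix_(i, j) N j i ord0.

Lemma spectral_sumE f N :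
  spectral_sum f N = frame_mx N *m diag_mx (\row_i f i) *m (frame_mx N)^T.
Proof.
apply/matrixP => i j; rewrite summxE mxE; apply: eq_bigr => k _.
by rewrite mul_mx_diag !mxE; ring.
Qed.

Lemma frame_mx_tr_mul N : orthonormal_frame N ->
  (frame_mx N)^T *m frame_mx N = 1%:M.
Proof.
move=> hN; apply/matrixP => i j.
have /matrixP/(_ ord0 ord0) := hN i j.
rewrite !mxE eqxx mulr1n => <-.
by apply: eq_bigr => k _; rewrite !mxE.
Qed.

Lemma frame_mx_mul_tr N : orthonormal_frame N ->
  frame_mx N *m (frame_mx N)^T = 1%:M.
Proof. by move=> /frame_mx_tr_mul/mulmx1C. Qed.

Lemma tr_spectral_sum f N : (spectral_sum f N)^T = spectral_sum f N.
Proof. by rewrite spectral_sumE !trmx_mul trmxK tr_diag_mx mulmxA. Qed.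

Lemma mul_spectral_sum f g N : orthonormal_frame N ->
  spectral_sum f N *m spectral_sum g N = spectral_sum (fun i => f i * g i) N.
Proof.
move=> hN; rewrite !spectral_sumE !mulmxA.
rewrite -[X in X *m diag_mx (\row_i g i)]mulmxA frame_mx_tr_mul// mulmx1.
rewrite -[X in X *m _^T = _]mulmxA mulmx_diag.
by congr (_ *m diag_mx _ *m _); apply/rowP => i; rewrite !mxE.
Qed.

Lemma mxtrace_spectral_sum f N : orthonormal_frame N ->
  \tr (spectral_sum f N) = f 0 + f 1.
Proof.
move=> hN; rewrite spectral_sumE mxtrace_mulC mulmxA frame_mx_tr_mul// mul1mx.
by rewrite mxtrace_diag sum_ord2 !mxE.
Qed.

Lemma det_spectral_sum f N : orthonormal_frame N ->
  \det (spectral_sum f N) = f 0 * f 1.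
Proof.
move=> hN; rewrite spectral_sumE !det_mulmx mulrAC -det_mulmx frame_mx_mul_tr//.
rewrite det1 mul1r det_diag !big_ord_recl big_ord0 mulr1 !mxE.
by congr (_ * f _); apply/val_inj.
Qed.

Lemma spectral_sum1 N : orthonormal_frame N ->
  spectral_sum (fun=> 1) N = 1%:M.
Proof.
move=> hN; rewrite spectral_sumE -(frame_mx_mul_tr hN).
suff -> : diag_mx (\row__ 1) = 1%:M :> 'M[R]_2 by rewrite mulmx1.
by apply/matrixP => i j; rewrite !mxE.
Qed.

Lemma quad_spectral_sum f N (x : 'cV[R]_2) :
  (x^T *m spectral_sum f N *m x) ord0 ord0 =
  \sum_i f i * ((frame_mx N)^T *m x) i ord0 ^+ 2.
Proof.
rewrite spectral_sumE !mulmxA -(mulmxA _ _ x) -{1}(trmxK (frame_mx N)).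
rewrite -trmx_mul mxE; apply: eq_bigr => i _.
by rewrite mul_mx_diag !mxE; ring.
Qed.

Lemma PSym_spectral_sum f N : orthonormal_frame N -> (forall i, 0 < f i) ->
  PSym (spectral_sum f N).
Proof.
move=> hN f0; split; first exact: tr_spectral_sum.
move=> x x0; rewrite quad_spectral_sum.
have y0 : (frame_mx N)^T *m x != 0.
  apply: contra_neq x0 => /(congr1 (mulmx (frame_mx N))).
  by rewrite mulmxA frame_mx_mul_tr// mul1mx mulmx0.
have [i yi0] := cV_neq0 y0.
rewrite (bigD1 i)//= ltr_wpDr//.
  by apply: sumr_ge0 => j _; rewrite mulr_ge0 ?sqr_ge0// ltW.
by rewrite mulr_gt0// exprn_even_gt0.
Qed.

(** The quadratic form takes the value [f i] at the vector [N i]. *)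
Lemma spectral_sum_PSym_gt0 f N : orthonormal_frame N ->
  PSym (spectral_sum f N) -> forall i, 0 < f i.
Proof.
move=> hN [_ pos] i.
have E : (frame_mx N)^T *m N i = \col_j (i == j)%:R.
  apply/matrixP => j k; rewrite ord1 mxE [RHS]mxE eq_sym.
  have /matrixP/(_ ord0 ord0) := hN j i.
  rewrite !mxE eqxx mulr1n => <-.
  by apply: eq_bigr => l _; rewrite !mxE.
have Ni0 : N i != 0.
  apply/eqP => Ni; move: E; rewrite Ni mulmx0 => /matrixP/(_ i ord0).
  by rewrite !mxE eqxx => /eqP; rewrite eq_sym oner_eq0.
have := pos _ Ni0; rewrite quad_spectral_sum E (bigD1 i)//= big1.
  by rewrite mxE eqxx expr1n mulr1 addr0.
by move=> j; rewrite mxE eq_sym => /negPf->; rewrite expr0n mulr0.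
Qed.

(* With [Z = Q^T P], equality of the spectral sums reads
   [f i * Z i j = Z i j * g j]; hence [Z i j] vanishes unless
   [f i = g j], and [h] may be applied. *)
Lemma spectral_sum_functional f g N M (h : R -> R) :
  orthonormal_frame N -> orthonormal_frame M ->
  spectral_sum f N = spectral_sum g M ->
  spectral_sum (h \o f) N = spectral_sum (h \o g) M.
Proof.
move=> hN hM; rewrite !spectral_sumE.
set Q := frame_mx N; set P := frame_mx M => E.
have key (a b : 'I_2 -> R) :
    Q *m diag_mx (\row_i a i) *m Q^T = P *m diag_mx (\row_i b i) *m P^T <->
    diag_mx (\row_i a i) *m (Q^T *m P) = (Q^T *m P) *m diag_mx (\row_i b i).
  split=> [/(congr1 (fun Z => Q^T *m Z *m P))|
           /(congr1 (fun Z => Q *m Z *m P^T))].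
    rewrite !mulmxA frame_mx_tr_mul// mul1mx => ->.
    by rewrite -!mulmxA frame_mx_tr_mul// mulmx1.
  rewrite !mulmxA frame_mx_mul_tr// mul1mx => <-.
  by rewrite -!mulmxA frame_mx_mul_tr// mulmx1.
apply/key; move/key: E => /matrixP E; apply/matrixP => i j.
have := E i j; rewrite !mul_diag_mx !mul_mx_diag !mxE /=.
set z := (\sum__ _) => /eqP; rewrite mulrC -subr_eq0 -mulrBr mulf_eq0.
by rewrite subr_eq0 => /orP[/eqP->|/eqP->]; [rewrite mulr0 mul0r|rewrite mulrC].
Qed.

(** [xget] may pick a logarithm built from another decomposition; [spectral_sum_functional] with
    [h = ln] identifies the two. *)
Lemma logm_spectral_sum f N : orthonormal_frame N -> (forall i, 0 < f i) ->
  logm (spectral_sum f N) = spectral_sum (@ln R \o f) N.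
Proof.
move=> hN f0; rewrite /logm; case: xgetP => [L _ /=|].
  by move=> [g [M [_ [hM E] ->]]]; symmetry; exact: spectral_sum_functional.
by move=> /(_ (spectral_sum (@ln R \o f) N))[]; exists f, N.
Qed.

(** The diagonal entries are the values of the quadratic form of [V] at the columns of [X], one of
    which is nonzero. *)
Lemma mxtrace_PSym_gt0 X V : PSym V -> X != 0 -> 0 < \tr (X^T *m V *m X).
Proof.
move=> [_ Vpos] X0.
have E i : (X^T *m V *m X) i i = ((col i X)^T *m V *m col i X) ord0 ord0.
  rewrite !mxE; apply: eq_bigr => k _; rewrite !mxE; congr (_ * _).
  by apply: eq_bigr => l _; rewrite !mxE.
have [i Xi0] : exists i, col i X != 0.
  apply/existsP; apply: contra_neqT X0; rewrite negb_exists => /forallP h.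
  apply/matrixP => i j; have := h j; rewrite negbK => /eqP/matrixP/(_ i ord0).
  by rewrite !mxE.
rewrite /mxtrace (bigD1 i)//= ltr_wpDr//; last by rewrite E Vpos.
apply: sumr_ge0 => j _; rewrite E.
have [->|/Vpos/ltW//] := eqVneq (col j X) 0.
by rewrite mulmx0 mxE.
Qed.

(* With [D = U - V], [U^2 = V^2] gives [U D + D V = 0]; multiplying by [D]
   and taking traces, [tr (D U D) + tr (D V D) = 0]. *)
Lemma PSym_sqrt_inj U V : PSym U -> PSym V -> U *m U = V *m V -> U = V.
Proof.
move=> psU psV UV; apply/eqP; rewrite -subr_eq0; apply/negPn/negP => D0.
have DT : (U - V)^T = U - V.
  by case: psU psV => [UT _] [VT _]; rewrite [LHS]raddfB/= UT VT.
have := mxtrace_PSym_gt0 psV D0; have := mxtrace_PSym_gt0 psU D0.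
rewrite DT; set D := U - V => t1 t2.
suff t0 : \tr (D *m U *m D) + \tr (D *m V *m D) = 0.
  by have := addr_gt0 t1 t2; rewrite t0 ltxx.
rewrite (mxtrace_mulC (D *m V) D) -!mulmxA -raddfD/= -mulmxDr.
suff -> : U *m D + D *m V = 0 by rewrite mulmx0; exact: mxtrace0.
by rewrite mulmxBl mulmxBr UV addrA subrK subrr.
Qed.

Lemma sqrtm_spectral_sum f N : orthonormal_frame N -> (forall i, 0 < f i) ->
  sqrtm (spectral_sum (fun i => f i ^+ 2) N) = spectral_sum f N.
Proof.
move=> hN f0.
have E :
    spectral_sum f N *m spectral_sum f N = spectral_sum (fun i => f i ^+ 2) N.
  by rewrite mul_spectral_sum.
rewrite /sqrtm; case: xgetP => [U _ /= [psU UU]|].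
  by apply: PSym_sqrt_inj => //; [exact: PSym_spectral_sum|rewrite UU].
by move=> /(_ (spectral_sum f N))[]; split => //; exact: PSym_spectral_sum.
Qed.

End Spectral.

(** * Diagonalization in the plane, singular values, and the energy in terms of them *)

Section Planar.
Variable R : realType.
Implicit Types (X F : 'M[R]_2) (N : 'I_2 -> 'cV[R]_2) (f g : 'I_2 -> R).

Definition vec2 (x y : R) : 'cV[R]_2 := \col_i (if i == 0 then x else y).

Definition pair2 T (x y : T) : 'I_2 -> T := fun i => if i == 0 then x else y.

(** [c] and [s] play the cosine and sine of an angle; keeping the pair avoids trigonometric
    functions. *)
Definition rotation_frame (c s : R) : 'I_2 -> 'cV[R]_2 :=
  pair2 (vec2 c s) (vec2 (- s) c).

Lemma rotation_frameP c s : c ^+ 2 + s ^+ 2 = 1 ->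
  orthonormal_frame (rotation_frame c s).
Proof.
move=> cs1; apply: ord2P; apply: ord2P; apply/matrixP => i j;
  rewrite !ord1 mxE sum_ord2 !mxE/= ?mulr1n -?cs1; ring.
Qed.

Lemma spectral_sum_rotation (c s a b : R) (i j : 'I_2) :
  spectral_sum (pair2 a b) (rotation_frame c s) i j =
  if i == 0 then
    if j == 0 then a * c ^+ 2 + b * s ^+ 2 else (a - b) * (c * s)
  else
    if j == 0 then (a - b) * (c * s) else a * s ^+ 2 + b * c ^+ 2.
Proof.
rewrite /spectral_sum sum_ord2 !mxE /=.
by move: i j; apply: ord2P; apply: ord2P; rewrite /pair2/=; ring.
Qed.

(** Spectral theorem in coordinates for the matrix with rows [(p, q)] and [(q, r)]: its
    characteristic polynomial has discriminant [(p - r)^2 + 4 q^2 >= 0]. *)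
Lemma sym_diagonalization (p q r : R) : exists c s a b : R,
  [/\ c ^+ 2 + s ^+ 2 = 1, p = a * c ^+ 2 + b * s ^+ 2,
      q = (a - b) * (c * s) & r = a * s ^+ 2 + b * c ^+ 2].
Proof.
have [->|q0] := eqVneq q 0; first by exists 1, 0, p, r; split; ring.
have q2 : 0 < q ^+ 2 by rewrite exprn_even_gt0.
have D0 : 0 <= (p - r) ^+ 2 + 4 * q ^+ 2 by have := sqr_ge0 (p - r); lra.
pose d := Num.sqrt ((p - r) ^+ 2 + 4 * q ^+ 2).
have d2 : d ^+ 2 = (p - r) ^+ 2 + 4 * q ^+ 2 by rewrite sqr_sqrtr.
pose y := (r - p + d) / 2.
have n0 : 0 < q ^+ 2 + y ^+ 2 by rewrite ltr_pwDl// sqr_ge0.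
pose n := Num.sqrt (q ^+ 2 + y ^+ 2).
have n2 : n ^+ 2 = q ^+ 2 + y ^+ 2 by rewrite sqr_sqrtr// ltW.
have nn0 : n != 0 by rewrite gt_eqF// sqrtr_gt0.
have yE : y ^+ 2 = q ^+ 2 + (r - p) * y.
  have dE : d = 2 * y - (r - p) by rewrite /y; field.
  by move: d2; rewrite dE; lra.
(* [(q, y)] is an eigenvector for the larger eigenvalue [p + y]. *)
exists (q / n), (y / n), (p + y), (r - y).
have nM : n * n = q ^+ 2 + y ^+ 2 by rewrite -expr2.
have nM0 : q ^+ 2 + y ^+ 2 != 0 by rewrite gt_eqF.
have qnE (u v : R) : (u / n) * (v / n) = u * v / (q ^+ 2 + y ^+ 2).
  by rewrite -nM; field.
rewrite !expr2 !qnE.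
(* The characteristic equation of [p + y]; the last three identities below are multiples of it. *)
have Z : y ^+ 2 - q ^+ 2 - (r - p) * y = 0 by rewrite yE; ring.
split; apply/eqP; rewrite -subr_eq0; apply/eqP.
- by field.
- rewrite -[RHS](mulr0 (y / (q ^+ 2 + y ^+ 2))) -Z; by field.
- rewrite -[RHS](mulr0 (- q / (q ^+ 2 + y ^+ 2))) -Z; by field.
- rewrite -[RHS](mulr0 (- y / (q ^+ 2 + y ^+ 2))) -Z; by field.
Qed.

Lemma sym_spectral X : X^T = X ->
  exists N f, orthonormal_frame N /\ X = spectral_sum f N.
Proof.
move=> /matrixP XT.
have [c [s [a [b [cs p q r]]]]] := sym_diagonalization (X 0 0) (X 0 1) (X 1 1).
exists (rotation_frame c s), (pair2 a b); split; first exact: rotation_frameP.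
have q' : X 1 0 = X 0 1 by rewrite -[LHS]XT mxE.
by apply: matrix2P; rewrite spectral_sum_rotation/= ?q'.
Qed.

Lemma PSym_gram F : GLplus F -> PSym (F^T *m F).
Proof.
move=> F0; split; first by rewrite trmx_mul trmxK.
move=> x x0.
have Fu : F \in unitmx by rewrite unitmxE unitfE gt_eqF.
have y0 : F *m x != 0.
  apply: contra_neq x0 => /(congr1 (mulmx (invmx F))).
  by rewrite mulKmx// mulmx0.
rewrite mulmxA -trmx_mul -mulmxA; set y := F *m x in y0 *.
have [i yi0] := cV_neq0 y0.
rewrite mxE (bigD1 i)//= ltr_wpDr//.
  by apply: sumr_ge0 => j _; rewrite mxE -expr2 sqr_ge0.
by rewrite mxE -expr2 exprn_even_gt0.
Qed.

Lemma logm_right_stretch F N f : orthonormal_frame N -> (forall i, 0 < f i) ->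
  F^T *m F = spectral_sum (fun i => f i ^+ 2) N ->
  logm (right_stretch F) = spectral_sum (@ln R \o f) N.
Proof.
move=> hN f0 E.
by rewrite /right_stretch E sqrtm_spectral_sum// logm_spectral_sum.
Qed.

Lemma singular_values F : GLplus F -> exists N f,
  [/\ orthonormal_frame N, forall i, 0 < f i,
      F^T *m F = spectral_sum (fun i => f i ^+ 2) N,
      \det F = f 0 * f 1 & frobenius_sq F = f 0 ^+ 2 + f 1 ^+ 2].
Proof.
move=> F0; have psC := PSym_gram F0.
have [N [mu [hN E]]] := sym_spectral (proj1 psC).
have mu0 i : 0 < mu i by apply: (spectral_sum_PSym_gt0 hN); rewrite -E.
exists N, (fun i => Num.sqrt (mu i)).
have sq i : Num.sqrt (mu i) ^+ 2 = mu i by rewrite sqr_sqrtr// ltW.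
split=> //.
- by move=> i; rewrite sqrtr_gt0.
- by rewrite E; apply: eq_bigr => i _; rewrite sq.
(* [F^T *m F] determines only the square of [\det F]; positivity fixes the sign. *)
- have d0 : 0 <= \det F := ltW F0.
  have m0 : 0 <= Num.sqrt (mu 0) * Num.sqrt (mu 1).
    by rewrite mulr_ge0 ?sqrtr_ge0.
  apply/eqP; rewrite -(@eqrXn2 _ 2)// exprMn !sq.
  by rewrite expr2 -{1}det_tr -det_mulmx E det_spectral_sum.
- by rewrite /frobenius_sq mxtrace_mulC E mxtrace_spectral_sum// !sq.
Qed.

(** [dev2] subtracts the mean from both eigenvalues, leaving plus and minus [(f 0 - f 1) / 2]. *)
Lemma frobenius_sq_dev2_spectral_sum f N : orthonormal_frame N ->
  frobenius_sq (dev2 (spectral_sum f N)) = (f 0 - f 1) ^+ 2 / 2.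
Proof.
move=> hN.
pose g i := f i - (f 0 + f 1) / 2.
have -> : dev2 (spectral_sum f N) = spectral_sum g N.
  rewrite /dev2 mxtrace_spectral_sum// -(spectral_sum1 hN) /spectral_sum.
  rewrite scaler_sumr -sumrB; apply: eq_bigr => i _.
  by rewrite scale1r -scalerBl mulrC.
rewrite /frobenius_sq tr_spectral_sum mul_spectral_sum// mxtrace_spectral_sum//.
by rewrite /g; field.
Qed.

Lemma cosh_ln_sub (x y : R) : 0 < x -> 0 < y ->
  cosh (ln x - ln y) = (x ^+ 2 + y ^+ 2) / (2 * (x * y)).
Proof.
move=> x0 y0; rewrite /cosh opprB !expRD !expRN !lnK//.
by field; rewrite !gt_eqF.
Qed.

(** Here [s] is the difference of the logarithms of the singular values. Its [cosh] is rational in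
    the entries of [F], so no eigenvalues are needed afterwards. *)
Lemma dev2_log_right_stretch F : GLplus F -> exists s,
  expR (frobenius_sq (dev2 (logm (right_stretch F)))) = gauss s /\
  cosh s = frobenius_sq F / (2 * \det F).
Proof.
move=> /singular_values[N [f [hN f0 E detE frobE]]].
exists (ln (f 0) - ln (f 1)); split.
  by rewrite (logm_right_stretch hN f0 E) frobenius_sq_dev2_spectral_sum.
by rewrite cosh_ln_sub// detE frobE.
Qed.

End Planar.

(** * Convexity of the energy without plastic stretch along rank-one lines *)

Section RankOne.
Variable R : realType.
Implicit Types (F : 'M[R]_2) (N : 'I_2 -> 'cV[R]_2) (xi eta : 'cV[R]_2).

Lemma det_mx22 F : \det F = F 0 0 * F 1 1 - F 0 1 * F 1 0.
Proof.
rewrite (expand_det_row _ ord0) sum_ord2 /cofactor !det_mx11 !mxE/=.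
rewrite expr0 expr1 mul1r mulN1r mulrN.
by congr (_ * F _ _ - _ * F _ _); apply/val_inj.
Qed.

(** The term quadratic in [t] vanishes because [outer xi eta] has determinant 0. *)
Lemma det_rank_one F xi eta (t : R) :
  \det (F + t *: outer xi eta) =
  \det F + t * (\det (F + outer xi eta) - \det F).
Proof. by rewrite !det_mx22 !mxE; ring. Qed.

Lemma convex_comb_gt0 (a b p q : R) : 0 < a -> 0 < b ->
  0 <= p -> 0 <= q -> p + q = 1 -> 0 < p * a + q * b.
Proof.
move=> a0 b0 p0 q0 pq.
have [p1|p1] := eqVneq p 0.
  by move: pq; rewrite p1 !add0r mul0r add0r => ->; rewrite mul1r.
by rewrite ltr_pwDl ?mulr_ge0 ?(ltW b0)// mulr_gt0// lt_neqAle eq_sym p1.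
Qed.

(** Joint convexity of [x^2 / a] for [a > 0]: after clearing the left denominator the gap is an
    explicit square with nonnegative weight. *)
Lemma sqr_div_convex (x y a b p q : R) : 0 < a -> 0 < b ->
  0 <= p -> 0 <= q -> p + q = 1 ->
  (p * x + q * y) ^+ 2 / (p * a + q * b) <= p * (x ^+ 2 / a) + q * (y ^+ 2 / b).
Proof.
move=> a0 b0 p0 q0 pq.
have d0 : 0 < p * a + q * b by exact: convex_comb_gt0.
rewrite ler_pdivrMr// -subr_ge0.
have -> : (p * (x ^+ 2 / a) + q * (y ^+ 2 / b)) * (p * a + q * b)
    - (p * x + q * y) ^+ 2 = p * q * (x * b - y * a) ^+ 2 / (a * b).
  by field; rewrite !gt_eqF.
apply: divr_ge0; last by rewrite mulr_ge0 ?(ltW a0) ?(ltW b0).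
by apply: mulr_ge0; [exact: mulr_ge0|exact: sqr_ge0].
Qed.

Lemma frobenius_sqE F :
  frobenius_sq F = F 0 0 ^+ 2 + F 0 1 ^+ 2 + F 1 0 ^+ 2 + F 1 1 ^+ 2.
Proof.
by rewrite /frobenius_sq /mxtrace sum_ord2 !mxE !sum_ord2 !mxE; ring.
Qed.

(* Convexity of the energy on segments along which the determinant is affine:
   [|X|^2 / det X] is convex there, being a sum of terms [x^2 / y]. *)
Lemma energy_convex (X Y Z : 'M[R]_2) (p q : R) : GLplus X -> GLplus Y ->
  0 <= p -> 0 <= q -> p + q = 1 ->
  Z = p *: X + q *: Y -> \det Z = p * \det X + q * \det Y ->
  expR (frobenius_sq (dev2 (logm (right_stretch Z)))) <=
  p * expR (frobenius_sq (dev2 (logm (right_stretch X)))) +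
  q * expR (frobenius_sq (dev2 (logm (right_stretch Y)))).
Proof.
move=> X0 Y0 p0 q0 pq ZE dZ.
have Z0 : GLplus Z by rewrite /GLplus/= dZ; exact: convex_comb_gt0.
have [sz [-> cz]] := dev2_log_right_stretch Z0.
have [sx [-> cx]] := dev2_log_right_stretch X0.
have [sy [-> cy]] := dev2_log_right_stretch Y0.
have cosh_convex : cosh sz <= p * cosh sx + q * cosh sy.
  have E (A : 'M[R]_2) : frobenius_sq A / (2 * \det A) =
    2^-1 * (A 0 0 ^+ 2 / \det A + A 0 1 ^+ 2 / \det A
     + A 1 0 ^+ 2 / \det A + A 1 1 ^+ 2 / \det A).
    by rewrite frobenius_sqE invfM; ring.
  rewrite cx cy cz !E dZ.
  have H i j : Z i j ^+ 2 / (p * \det X + q * \det Y) <=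
      p * (X i j ^+ 2 / \det X) + q * (Y i j ^+ 2 / \det Y).
    by rewrite ZE !mxE; exact: sqr_div_convex.
  by have := H 0 0; have := H 0 1; have := H 1 0; have := H 1 1; lra.
(* The supporting line at [sz] is averaged over [sx] and [sy]; since [m >= 0], [cosh_convex] makes
   its slope term nonnegative. *)
have [m m0 supp] := gauss_cosh_support sz.
have hx := ler_wpM2l p0 (supp sx); have hy := ler_wpM2l q0 (supp sy).
apply: le_trans (lerD hx hy).
have -> : p * (gauss sz + m * (cosh sx - cosh sz)) +
   q * (gauss sz + m * (cosh sy - cosh sz)) =
   (p + q) * gauss sz + m * (p * cosh sx + q * cosh sy - (p + q) * cosh sz).
  by ring.
by rewrite pq !mul1r lerDl mulr_ge0// subr_ge0.
Qed.

Lemma rank_one_convex_energy :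
  rank_one_convex (fun F : 'M[R]_2 =>
    expR (frobenius_sq (dev2 (logm (right_stretch F))))).
Proof.
move=> F F0 xi eta l x y; rewrite !inE /= => x0 y0.
pose p : R := l%:inum; pose q : R := 1 - p.
have pq : p + q = 1 by rewrite addrC subrK.
pose Z := F + (p * x + q * y) *: outer xi eta.
apply: (@energy_convex _ _ Z p q x0 y0) => //; rewrite ?/Z.
- by rewrite /p ge0.
- by rewrite subr_ge0 /p le1.
- by apply/matrixP => i j; rewrite !mxE -[F i j in LHS]mul1r -pq; ring.
- rewrite (det_rank_one F _ _ (_ + _)) (det_rank_one F _ _ x).
  rewrite (det_rank_one F _ _ y).
  by rewrite -[X in X + _ = _]mul1r -pq; ring.
Qed.

(** * The counterexample: simple shears and the plastic stretch [diag (2, 1/2)] *)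

Definition plastic_stretch : 'M[R]_2 :=
  spectral_sum (pair2 2 2^-1) (rotation_frame 1 0).

Definition shear (t : R) : 'M[R]_2 := 1%:M + t *: outer (vec2 0 1) (vec2 1 0).

Lemma logm_right_stretch_rotation F (c s a b : R) : c ^+ 2 + s ^+ 2 = 1 ->
  0 < a -> 0 < b ->
  F^T *m F = spectral_sum (pair2 (a ^+ 2) (b ^+ 2)) (rotation_frame c s) ->
  logm (right_stretch F) =
    spectral_sum (pair2 (ln a) (ln b)) (rotation_frame c s).
Proof.
move=> cs a0 b0 E.
have hN := rotation_frameP cs.
have P : forall i, 0 < pair2 a b i by apply: ord2P.
rewrite (logm_right_stretch hN P) ?E; first by rewrite /spectral_sum !sum_ord2.
by rewrite /spectral_sum !sum_ord2.
Qed.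

Lemma logm_plastic_stretch :
  logm plastic_stretch =
    spectral_sum (pair2 (ln 2) (- ln 2)) (rotation_frame 1 0).
Proof.
have P : forall i, 0 < pair2 (2 : R) 2^-1 i.
  by apply: ord2P; rewrite /pair2/= ?invr_gt0.
rewrite logm_spectral_sum//; last by apply: rotation_frameP; ring.
by rewrite /spectral_sum !sum_ord2 /pair2/= lnV// posrE.
Qed.

Lemma dev2_spectral_sum_traceless (a b : R) N : orthonormal_frame N ->
  a + b = 0 -> dev2 (spectral_sum (pair2 a b) N) = spectral_sum (pair2 a b) N.
Proof.
move=> hN ab.
by rewrite /dev2 mxtrace_spectral_sum// /pair2/= ab mulr0 scale0r subr0.
Qed.

(** [shear 0] is the identity, whose logarithm is 0, so only the squared norm of
    [diag (ln 2, - ln 2)] remains. *)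
Lemma energy_shear0 :
  frobenius_sq (dev2 (logm (right_stretch (shear 0))) -
    dev2 (logm plastic_stretch)) = 2 * ln 2 ^+ 2.
Proof.
have r1 : (1 : R) ^+ 2 + 0 ^+ 2 = 1 by ring.
rewrite (@logm_right_stretch_rotation _ 1 0 1 1)//; last first.
  rewrite /shear scale0r addr0 trmx1 mulmx1.
  by apply: matrix2P; rewrite spectral_sum_rotation !mxE/=; ring.
rewrite logm_plastic_stretch ln1.
rewrite !(dev2_spectral_sum_traceless (rotation_frameP r1)) ?subrr ?addr0//.
rewrite frobenius_sqE !mxE !spectral_sum_rotation/=; ring.
Qed.

(* The right stretch of these shears has eigenvalues [2] and [1/2], with
   eigenvectors [(2, e)] and [(-e, 2)] up to normalisation. *)
Lemma energy_shear (e : R) : e ^+ 2 = 1 ->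
  frobenius_sq (dev2 (logm (right_stretch (shear (e * (3 / 2))))) -
    dev2 (logm plastic_stretch)) = 8 / 5 * ln 2 ^+ 2.
Proof.
move=> e2.
have r1 : (1 : R) ^+ 2 + 0 ^+ 2 = 1 by ring.
(* The length of the eigenvector [(2, e)]. *)
pose r : R := Num.sqrt 5.
have r5 : r * r = 5 by rewrite -expr2 sqr_sqrtr.
have r0 : r != 0 by rewrite gt_eqF// sqrtr_gt0.
have cc : (2 / r) ^+ 2 = 4 / 5 by rewrite -[in RHS]r5; field.
have ss : (e / r) ^+ 2 = 1 / 5 by rewrite -[in RHS]r5 -e2; field.
have sc : 2 / r * (e / r) = e * (2 / 5) by rewrite -[in RHS]r5; field.
have r2 : (2 / r) ^+ 2 + (e / r) ^+ 2 = 1 by rewrite cc ss; field.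
rewrite (@logm_right_stretch_rotation _ (2 / r) (e / r) 2 2^-1)//; last first.
  by apply: matrix2P; rewrite spectral_sum_rotation/= ?cc ?ss ?sc;
    rewrite !(mxE, sum_ord2)/=; lra.
rewrite logm_plastic_stretch lnV ?posrE//.
rewrite (dev2_spectral_sum_traceless (rotation_frameP r1)) ?subrr//.
rewrite (dev2_spectral_sum_traceless (rotation_frameP r2)) ?subrr//.
rewrite frobenius_sqE; rewrite !mxE !spectral_sum_rotation/= cc ss sc.
(* The difference of logarithms has diagonal entries [-2/5 ln 2] and [2/5 ln 2] and off-diagonal
   entries [4/5 e ln 2]; the target is put in this form, with [e] free, for [field]. *)
have -> : 8 / 5 * ln 2 ^+ 2 = (8 + 32 * e ^+ 2) / 25 * ln 2 ^+ 2 :> R.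
  by rewrite e2; field.
by field.
Qed.

Lemma not_rank_one_convex_energy :
  ~ rank_one_convex (fun F : 'M[R]_2 =>
      expR (frobenius_sq
        (dev2 (logm (right_stretch F)) - dev2 (logm plastic_stretch)))).
Proof.
have det_shear t : \det (shear t) = 1 by rewrite det_mx22 !mxE/=; ring.
have F0 : GLplus (1%:M : 'M[R]_2) by rewrite /GLplus/= det1 ltr01.
have half01 : 0 <= (2^-1 : R) <= 1 by lra.
pose half : {i01 R} := Itv01 (proj1 (andP half01)) (proj2 (andP half01)).
(* The endpoints are written as products to match [energy_shear] with [e = 1] and [e = -1]; their
   midpoint is [t = 0]. *)
move=> /(_ _ F0 (vec2 0 1) (vec2 1 0) half (1 * (3 / 2)) (-1 * (3 / 2))).
have mem (t : R^o) : t \in [set t |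
    GLplus (1%:M + (t : R) *: outer (vec2 0 1) (vec2 1 0))]%classic.
  by rewrite inE/= /GLplus /= (det_shear t) ltr01.
move=> /(_ (mem _) (mem _)).
pose W (t : R) := expR (frobenius_sq
  (dev2 (logm (right_stretch (shear t))) - dev2 (logm plastic_stretch))).
have W0 : W 0 = expR (2 * ln 2 ^+ 2) by rewrite /W energy_shear0.
have W1 e : e ^+ 2 = 1 -> W (e * (3 / 2)) = expR (8 / 5 * ln 2 ^+ 2).
  by move=> e2; rewrite /W energy_shear.
change (W (2^-1 * (1 * (3 / 2)) + (1 - 2^-1) * (-1 * (3 / 2))) <=
  2^-1 * W (1 * (3 / 2)) + (1 - 2^-1) * W (-1 * (3 / 2)) -> False).
move: W W0 W1 => W W0 W1.
have -> : 2^-1 * (1 * (3 / 2)) + (1 - 2^-1) * (-1 * (3 / 2)) = 0 :> R by field.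
rewrite W0 !W1; try ring.
(* Both endpoint values coincide, so it remains to see that [8/5 (ln 2)^2 < 2 (ln 2)^2]. *)
apply/negP; rewrite -ltNge -mulrDl addrC subrK mul1r ltr_expR.
have l0 : 0 < ln (2 : R) by rewrite ln_gt0// ltr1n.
have : 0 < ln (2 : R) ^+ 2 by rewrite exprn_gt0.
lra.
Qed.

End RankOne.

Theorem lemma3p1 (R : realType) :
  exists Up : 'M[R]_2,
    [/\ PSym Up,
        ~ rank_one_convex (fun F : 'M[R]_2 =>
            expR (frobenius_sq
              (dev2 (logm (right_stretch F)) - dev2 (logm Up))))
      & rank_one_convex (fun F : 'M[R]_2 =>
            expR (frobenius_sq (dev2 (logm (right_stretch F)))))].
Proof.
exists (plastic_stretch R); split.
- apply: PSym_spectral_sum; first by apply: rotation_frameP; ring.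
  by apply: ord2P; rewrite /pair2/= ?invr_gt0.
- exact: not_rank_one_convex_energy.
- exact: rank_one_convex_energy.
Qed.
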